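(* Let $(P,\preceq,\vee)$ be a locally finite join semilattice, $S=\{x_1,x_2,\ldots,x_n\}$ a finite subset of $P$ (with $n\ge 1$) such that $x_i\preceq x_j$ only if $i\leq j$, $f:P\to\mathbb{C}$ a function on $P$, and $d\ge 2$ an integer. Let $S^{\vee d}=\{y_1,y_2,\ldots,y_r\}$, $r=\#S^{\vee d}$, be ordered such that $y_i\preceq y_j$ only if $i\leq j$, and assume that $f$ satisfies \[ c_k=\sum_{s:\,y_k\preceq y_s}f(y_s)\,\mu_{S^{\vee d}}(y_k,y_s)\neq 0\quad\text{for all }k\in\{1,2,\ldots,r\}. \] Then \[ 2\,\# S^{\vee\lfloor d/2\rfloor}-\# S^{\vee d}\leq \mathrm{rank}_{\mathrm{CP}}[S_d]_f\leq \mathrm{rank}_{\mathrm{Sym}}[S_d]_f\leq \# S^{\vee d}. \] If moreover $n\leq\lfloor d/2\rfloor$, then \[ \mathrm{rank}_{\mathrm{CP}}[S_d]_f=\mathrm{rank}_{\mathrm{Sym}}[S_d]_f=\# S^{\vee\lfloor d/2\rfloor}. \]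
   Context: A poset $(P,\preceq)$ is locally finite if $\{z\in P\mid x\preceq z\preceq y\}$ is finite for all $x,y\in P$. A join semilattice is a nonempty poset in which any two elements $x,y$ have a least upper bound $x\vee y$. For $S=\{x_1,\ldots,x_n\}\subset P$ and an integer $k\ge 1$, $S^{\vee k}=\{x_{i_1}\vee\cdots\vee x_{i_k}\mid 1\leq i_1\leq\cdots\leq i_k\leq n\}$, and $\#$ denotes cardinality. The order $d$ join tensor on $S$ with respect to $f$ is the $n$-dimensional order $d$ tensor with $([S_d]_f)_{i_1,\ldots,i_d}=f(x_{i_1}\vee\cdots\vee x_{i_d})$, $i_1,\ldots,i_d\in\{1,\ldots,n\}$. $\mu_{S^{\vee d}}$ denotes the Möbius function of the finite poset $(S^{\vee d},\preceq)$: $\mu(x,x)=1$, $\mu(x,y)=-\sum_{x\preceq z\prec y}\mu(x,z)$ if $x\prec y$ (sum over $z\in S^{\vee d}$), and $\mu(x,y)=0$ otherwise. A polyadic decomposition of an $n$-dimensional order $d$ complex tensor $A$ is a representation $A_{i_1,\ldots,i_d}=\sum_{k=1}^{r}c_kB^{(1)}_{i_1,k}B^{(2)}_{i_2,k}\cdots B^{(d)}_{i_d,k}$ for all $i_1,\ldots,i_d\in\{1,\ldots,n\}$, with $r$ a positive integer, $c_k\in\mathbb{C}$, and $B^{(1)},\ldots,B^{(d)}\in\mathbb{C}^{n\times r}$. The smallest possible $r$ is the canonical rank $\mathrm{rank}_{\mathrm{CP}}A$. For symmetric $A$, the smallest possible $r$ among polyadic decompositions with $B^{(1)}=B^{(2)}=\cdots=B^{(d)}$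 is the symmetric rank $\mathrm{rank}_{\mathrm{Sym}}A$. *)

(* Defs.v *)
From HB Require Import structures.
From mathcomp Require Import all_boot all_order all_algebra.
From mathcomp Require Import finmap complex.
From mathcomp Require Import boolp classical_sets cardinality reals.

Set Implicit Arguments.
Unset Strict Implicit.
Unset Printing Implicit Defensive.

Import Order.TTheory GRing.Theory Num.Theory.

Local Open Scope ring_scope.
Local Open Scope fset_scope.

Definition locally_finite (disp : Order.disp_t) (P : porderType disp) : Prop :=
  forall a b : P, finite_set [set z : P | (a <= z <= b)%O]%classic.

Section Mobius.
Variables (disp : Order.disp_t) (P : porderType disp) (T : {fset P}).
Implicit Types a b z : P.

(* [m] is recursion fuel. A recursive call strictly shrinks the set of
   [z \in T] with [a <= z < b], so [#|` T|] is always enough; [mobius_id],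
   [mobius_lt] and [mobius_nle] are the usual defining equations. *)
Fixpoint mobius_rec (m : nat) a b : int :=
  if a == b then 1
  else if (a < b)%O then
    if m is m'.+1 then - \sum_(z <- T | (a <= z < b)%O) mobius_rec m' a z
    else 0
  else 0.

Definition mobius a b : int := mobius_rec #|` T| a b.

Let below a b : nat := count (fun z => (a <= z < b)%O) T.

Let below_lt a b z : z \in T -> (a <= z < b)%O -> (below a z < below a b)%N.
Proof.
move=> zT /andP[az zb].
have sub : subpred (predU (pred1 z) (fun w => (a <= w < z)%O))
                   (fun w => (a <= w < b)%O).
  move=> w /orP[/eqP->|/andP[aw wz]]; first by rewrite az zb.
  by rewrite aw (lt_trans wz zb).
apply: leq_trans (sub_count sub _).
have := count_predUI (pred1 z) (fun w => (a <= w < z)%O) T.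
rewrite [X in (_ + X)%N = _](eq_count (a2 := pred0)) ?count_pred0; last first.
  by move=> w /=; case: eqP => // ->; rewrite ltxx andbF.
by rewrite addn0 count_uniq_mem ?fset_uniq // zT add1n => ->.
Qed.

Let mobius_rec_stable m m' a b :
  (below a b <= m)%N -> (below a b <= m')%N ->
  mobius_rec m a b = mobius_rec m' a b.
Proof.
have sum0 (F : P -> int) c :
    (below a c <= 0)%N -> \sum_(z <- T | (a <= z < c)%O) F z = 0.
  move=> h; rewrite big1_seq // => z /andP[zac zT].
  by have := leq_trans (below_lt zT zac) h; rewrite ltn0.
elim: m m' b => [|m IH] [|m'] b hm hm' //=; do 2!case: ifP => // _.
- by rewrite sum0 ?oppr0.
- by rewrite sum0 ?oppr0.
congr (- _); rewrite big_seq_cond [RHS]big_seq_cond.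
apply: eq_bigr => z /andP[zT zab]; have lt := below_lt zT zab.
by apply: IH; rewrite -ltnS; apply: leq_trans lt _.
Qed.

Lemma mobius_id a : mobius a a = 1.
Proof. by rewrite /mobius; case: #|` T| => [|m] /=; rewrite eqxx. Qed.

Lemma mobius_lt a b : a \in T -> (a < b)%O ->
  mobius a b = - \sum_(z <- T | (a <= z < b)%O) mobius a z.
Proof.
move=> aT ab; have belowT c : (below a c <= #|` T|)%N by exact: count_size.
rewrite /mobius (@mobius_rec_stable _ #|` T|.+1) ?(leqW (belowT b)) //=.
by rewrite lt_eqF ?ab.
Qed.

Lemma mobius_nle a b : ~~ (a <= b)%O -> mobius a b = 0.
Proof.
move=> nab; have neq : (a == b) = false by apply: contraNF nab => /eqP->.
have nlt : (a < b)%O = false by apply: contraNF nab => /ltW.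
by rewrite /mobius; case: #|` T| => [|m] /=; rewrite neq nlt.
Qed.

End Mobius.

Section JoinPower.
Variables (disp : Order.disp_t) (P : joinSemilatticeType disp).

(* [P] need not have a least element, so the empty join is undefined. *)
Definition joins (s : seq P) : option P :=
  if s is a :: s' then Some (foldl Order.join a s') else None.

Definition join_power (n : nat) (x : 'I_n -> P) (k : nat) : {fset P} :=
  [fset p in pmap joins [seq [seq x j | j <- i] |
    i : k.-tuple 'I_n <- enum {: k.-tuple 'I_n} &
      sorted (fun j j' : 'I_n => (j <= j')%N) i]].

Lemma join_powerP (n : nat) (x : 'I_n -> P) (k : nat) (p : P) :
  reflect (exists2 i : k.-tuple 'I_n,
             sorted (fun j j' : 'I_n => (j <= j')%N) i &
             joins [seq x j | j <- i] = Some p)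
          (p \in join_power x k).
Proof.
rewrite !inE /= mem_pmap -map_comp; apply: (iffP mapP); case=> i.
  by rewrite mem_filter => /andP[hi _] ->; exists i.
by move=> hi <-; exists i; rewrite // mem_filter hi mem_enum.
Qed.

End JoinPower.

Section Tensor.
Variables (C : nzRingType) (n d : nat).

Definition tensor : Type := d.-tuple 'I_n -> C.

Definition is_polyadic (A : tensor) (r : nat)
    (c : 'I_r -> C) (B : 'I_d -> 'M[C]_(n, r)) : Prop :=
  forall i : d.-tuple 'I_n,
    A i = \sum_(k < r) c k * \prod_(j < d) B j (tnth i j) k.

Definition has_polyadic (A : tensor) (r : nat) : Prop :=
  (0 < r)%N /\ exists c B, @is_polyadic A r c B.

Definition has_sym_polyadic (A : tensor) (r : nat) : Prop :=
  (0 < r)%N /\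
  exists (c : 'I_r -> C) (B : 'M[C]_(n, r)), is_polyadic A c (fun=> B).

Definition is_smallest (Q : nat -> Prop) (r : nat) : Prop :=
  Q r /\ forall q, Q q -> (r <= q)%N.

Definition is_rank_CP (A : tensor) (r : nat) : Prop :=
  is_smallest (has_polyadic A) r.

Definition is_rank_Sym (A : tensor) (r : nat) : Prop :=
  is_smallest (has_sym_polyadic A) r.

End Tensor.

(* The default value 0 is only reached in the degenerate case [d = 0]. *)
Definition join_tensor (C : nzRingType) (disp : Order.disp_t)
    (P : joinSemilatticeType disp) (f : P -> C) (n d : nat) (x : 'I_n -> P) :
    tensor C n d :=
  fun i => oapp f 0 (joins [seq x j | j <- i]).
Arguments join_tensor {C disp P} f {n} d x.

(* Main.v *)
(* Let [T] be the set of [d]-fold joins, with elements [y k].  By Moebius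
   inversion on [T], [f p] is the sum of the [c k] over [p <= y k], so the join
   tensor is the sum over [k] of [c k] times the product over [j] of the
   indicators [x i_j <= y k]; this is a symmetric decomposition with #T terms.
   For the lower bound, flatten the tensor by grouping the first [m = d./2]
   indices and the last [e = d - m].  A decomposition with [q] terms factors the
   flattening through dimension [q], while the one above writes it as
   [U *m D *m V^T] with [D] invertible and [U], [V] zeta-like matrices having
   independent rows, so Sylvester's inequality gives rank at least
   #S^{v m} + #S^{v e} - #T.  When [n <= m] every join already uses at most [m]
   distinct arguments, so #S^{v m} = #T and the bounds coincide. *)
Require Import Defs.
From HB Require Import structures.
From mathcomp Require Import all_boot all_order all_algebra.
From mathcomp Require Import finmap complex.
From mathcomp Require Import boolp classical_sets cardinality reals.
From mathcomp Require Import zify.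

Set Implicit Arguments.
Unset Strict Implicit.
Unset Printing Implicit Defensive.

Import Order.TTheory GRing.Theory Num.Theory.

Local Open Scope ring_scope.
Local Open Scope fset_scope.

(** * Joins of finite sequences and the sets of k-fold joins *)

Section Joins.
Variables (disp : Order.disp_t) (P : joinSemilatticeType disp).

(** Universal property of the join: later identities between joins come from comparing upper bounds
    and antisymmetry, without unfolding the fold. *)
Lemma joins_le (s : seq P) (p z : P) :
  joins s = Some p -> (p <= z)%O = all (fun a => (a <= z)%O) s.
Proof.
case: s => //= a s [<-]; elim: s a => [|b s IH] a /=; first by rewrite andbT.
by rewrite IH leUx -andbA.
Qed.

Lemma joins_some (s : seq P) : (0 < size s)%N -> exists p, joins s = Some p.
Proof. by case: s => //= a s _; eexists. Qed.

Lemma joins_eq_mem (s t : seq P) : s =i t -> joins s = joins t.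
Proof.
move=> st; case: s t st => [|a s] [|b t] st //.
- by have := st b; rewrite in_nil mem_head.
- by have := st a; rewrite in_nil mem_head.
have [p sp] := @joins_some (a :: s) isT.
have [q tq] := @joins_some (b :: t) isT.
rewrite sp tq; congr Some; have pq z : (p <= z)%O = (q <= z)%O.
  by rewrite (joins_le z sp) (joins_le z tq) (eq_all_r st).
by apply/le_anti; rewrite pq lexx -pq lexx.
Qed.

Lemma joins_cat (s t : seq P) (p q w : P) :
    joins s = Some p -> joins t = Some q -> joins (s ++ t) = Some w ->
  w = (p `|` q)%O.
Proof.
move=> sp tq stw; have H z : (w <= z)%O = ((p `|` q)%O <= z)%O.
  by rewrite (joins_le z stw) all_cat leUx (joins_le z sp) (joins_le z tq).
by apply/le_anti; rewrite H lexx -H lexx.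
Qed.

Variables (n : nat) (x : 'I_n -> P).

(** Sorting the indices leaves their set, hence the join, unchanged, so the sortedness constraint
    loses nothing. *)
Lemma mem_join_power (k : nat) (i : k.-tuple 'I_n) (p : P) :
  joins [seq x j | j <- i] = Some p -> p \in join_power x k.
Proof.
move=> ip; pose leqI := fun j j' : 'I_n => (j <= j')%N.
apply/join_powerP; exists (sort_tuple leqI i).
  by apply: sort_sorted => a b; exact: leq_total.
rewrite -ip; apply: joins_eq_mem; apply: eq_mem_map.
by move=> a; rewrite mem_sort.
Qed.

(* A join only depends on the set of its arguments, so it can be padded with
   repetitions. *)
Lemma mem_join_power_pad (k : nat) (s : seq 'I_n) (p : P) :
    (size (undup s) <= k)%N -> joins [seq x j | j <- s] = Some p ->
  p \in join_power x k.
Proof.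
move=> sk sp; case: s sk sp => // a s sk sp.
set u := undup (a :: s) in sk; pose t := u ++ nseq (k - size u) a.
have size_t : size t == k by rewrite size_cat size_nseq subnKC.
apply: (@mem_join_power _ (Tuple size_t)); rewrite -sp.
apply: joins_eq_mem; apply: eq_mem_map => j.
rewrite mem_cat mem_undup mem_nseq.
by case: (j =P a) => [->|_]; rewrite ?mem_head // andbF orbF.
Qed.

(** A [k]-tuple over ['I_n] has at most [minn n k] distinct entries. The one hypothesis covers both
    growth in [k] and stabilisation from [n] on. *)
Lemma join_power_sub (k l : nat) :
  (minn n k <= l)%N -> {subset join_power x k <= join_power x l}.
Proof.
move=> kl p /join_powerP[i _ ip]; apply: mem_join_power_pad ip.
apply: leq_trans kl; rewrite leq_min; apply/andP; split; last first.
  by rewrite -[X in (_ <= X)%N](size_tuple i) size_undup.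
rewrite -[X in (_ <= X)%N]card_ord -(card_uniqP (undup_uniq i)).
exact: max_card.
Qed.

Lemma card_join_power_le (k l : nat) :
  (minn n k <= l)%N -> (#|` join_power x k| <= #|` join_power x l|)%N.
Proof. by move=> kl; exact/fsubset_leq_card/fsubsetP/join_power_sub. Qed.

Lemma card_join_power_gt0 (k : nat) :
  (0 < n)%N -> (0 < k)%N -> (0 < #|` join_power x k|)%N.
Proof.
case: n x => // n' x' _ k_gt0.
have [|p] := @joins_some [seq x' j | j <- [tuple (ord0 : 'I_n'.+1) | _ < k]].
  by rewrite size_map size_tuple.
move=> ip; rewrite cardfs_gt0; apply/fset0Pn; exists p.
apply/join_powerP; exists [tuple (ord0 : 'I_n'.+1) | _ < k] => //.
apply/(sortedP ord0) => j; rewrite size_tuple => jk.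
by rewrite -[j]/(val (Ordinal (ltnW jk))) -[j.+1]/(val (Ordinal jk)) -!tnth_nth
           !tnth_mktuple.
Qed.

End Joins.

(** * Möbius inversion and zeta matrices over an enumerated finite poset *)

Section Enumeration.
Variables (disp : Order.disp_t) (P : porderType disp) (T : {fset P}).
Variables (r : nat) (y : 'I_r -> P).
Hypothesis card_T : r = #|` T|.
Hypothesis T_enum : T = [fset y k | k in 'I_r].

Let y_mem k : y k \in T.
Proof. by rewrite T_enum in_imfset. Qed.

Let codomT : codom y =i T.
Proof.
move=> p; rewrite T_enum; apply/codomP/imfsetP => [[k ->]|[k _ ->]]; by exists k.
Qed.

(** The [r] values of [y] cover a set of [r] elements, so none repeats; injectivity of [y]
    follows. *)
Let codom_uniq : uniq (codom y).
Proof.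
apply: (@leq_size_uniq _ T); rewrite ?fset_uniq //.
  by move=> p; rewrite codomT.
by rewrite size_codom card_ord card_T.
Qed.

Let y_inj : injective y.
Proof. by apply/injectiveP. Qed.

Let sum_enum (F : P -> int) (Q : pred P) :
  \sum_(z <- T | Q z) F z = \sum_(k < r | Q (y k)) F (y k).
Proof.
rewrite (perm_big (codom y)); last first.
  by apply: uniq_perm; rewrite ?fset_uniq // => z; rewrite codomT.
by rewrite big_map big_enum_cond.
Qed.

Definition zeta_mx : 'M[int]_r := \matrix_(k, s) (y k <= y s)%O%:R.
Definition mobius_mx : 'M[int]_r := \matrix_(k, s) mobius T (y k) (y s).

Lemma mobius_zeta_mx : mobius_mx *m zeta_mx = 1%:M.
Proof.
(* With the term [t = s] split off, the rest runs over [y k <= y t < y s], which the defining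
   recursion of the Möbius function cancels. *)
apply/matrixP => k s; rewrite !mxE (bigD1 s) //= !mxE lexx mulr1.
rewrite (eq_bigr (fun t => if (y k <= y t < y s)%O then mobius T (y k) (y t)
                          else 0)); last first.
  move=> t ts; rewrite !mxE lt_neqAle (inj_eq y_inj) ts /=.
  case: (boolP (y k <= y t)%O) => [_|/mobius_nle->] /=; last by rewrite mul0r.
  by case: ifP; rewrite (mulr1, mulr0).
rewrite -big_mkcondr /=.
have -> : \sum_(t < r | (t != s) && (y k <= y t < y s)%O) mobius T (y k) (y t)
        = \sum_(z <- T | (y k <= z < y s)%O) mobius T (y k) z.
  rewrite sum_enum; apply: eq_bigl => t.
  by case: eqP => [->|//]; rewrite ltxx andbF.
have [->|ks] := eqVneq k s.
  rewrite mobius_id big1_seq ?addr0 // => z /andP[/andP[sz zs] _].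
  by have := le_lt_trans sz zs; rewrite ltxx.
have [kls|nkls] := boolP (y k <= y s)%O.
  rewrite (@mobius_lt _ _ T (y k) (y s)) ?addNr //.
  by rewrite lt_neqAle (inj_eq y_inj) ks.
rewrite mobius_nle // add0r big1_seq // => z /andP[/andP[kz zs] _].
by rewrite (le_trans kz (ltW zs)) in nkls.
Qed.

Lemma mobius_inversion (F : nzRingType) (f : P -> F) (k : 'I_r) :
  f (y k) = \sum_(t < r | (y k <= y t)%O) \sum_(s < r | (y t <= y s)%O)
              f (y s) * (mobius T (y t) (y s))%:~R.
Proof.
under eq_bigr => t _.
  rewrite (_ : \sum_(s < r | _) _ =
               \sum_(s < r) f (y s) * (mobius T (y t) (y s))%:~R); last first.
    rewrite [LHS]big_mkcond; apply: eq_bigr => s _.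
    by case: ifPn => // /mobius_nle->; rewrite mulr0.
  over.
rewrite exchange_big /= (bigD1 k) //= -[LHS]addr0.
have H s : \sum_(t < r | (y k <= y t)%O) f (y s) * (mobius T (y t) (y s))%:~R
         = f (y s) * (k == s)%:R.
  rewrite -mulr_sumr; congr (_ * _).
  (* The sum over [t] is an entry of zeta times Möbius; for square matrices the left inverse is also
     a right inverse. *)
  have /matrixP/(_ k s) := mulmx1C mobius_zeta_mx.
  rewrite !mxE => /(congr1 (fun a : int => a%:~R : F)).
  rewrite rmorph_sum /= mulrz_nat => <-; rewrite [LHS]big_mkcond.
  apply: eq_bigr => t _; rewrite !mxE rmorphM /=.
  by case: ifP; rewrite (mul1r, mul0r).
rewrite H eqxx mulr1; congr (_ + _)%R; rewrite big1 // => s sk.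
by rewrite H eq_sym (negPf sk) mulr0.
Qed.

Hypothesis y_ord : forall i j : 'I_r, (y i <= y j)%O -> (i <= j)%N.

(* Restricted to the columns indexed by its rows, the matrix is unitriangular. *)
Lemma row_free_zeta (F : fieldType) (a : nat) (s : 'I_a -> P) :
    injective s -> (forall p, s p \in T) ->
  row_free (\matrix_(p < a, k < r) ((s p <= y k)%O%:R : F)).
Proof.
move=> s_inj sT; apply: inj_row_free => v v0; apply/rowP => p.
have idx q : exists k, s q = y k by apply/codomP; rewrite codomT.
(* Strong induction on the position [k] of [s p]: column [k] of the product involves, besides [v] at
   [p], only entries at strictly earlier positions, by [y_ord]. *)
rewrite mxE; have [k] := idx p; have [m] := ubnP (k : nat).
elim: m k p => // m IH k p km pk.
have /rowP/(_ k) := v0; rewrite !mxE (bigD1 p) //= mxE pk lexx mulr1.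
rewrite big1 ?addr0 // => q qp; rewrite mxE.
have [k' qk'] := idx q; case: (boolP (s q <= y k)%O) => qk; last by rewrite mulr0.
rewrite qk' in qk; have k'k : (k' < k)%N.
  rewrite ltn_neqAle (y_ord qk) andbT; apply: contraNneq qp => /val_inj kk'.
  by apply/eqP/s_inj; rewrite qk' kk'.
by rewrite (IH k' q (leq_trans k'k km) qk') mul0r.
Qed.

Lemma mxrank_zeta_product (F : fieldType) (c : 'I_r -> F) (A B : {fset P}) :
    (forall k, c k != 0) -> A `<=` T -> B `<=` T ->
  (#|` A| + #|` B| - r <=
    \rank (\matrix_(p < #|` A|, q < #|` B|)
      (\sum_(k < r) c k * ((tnth (in_tuple A) p <= y k)%O%:R *
                           (tnth (in_tuple B) q <= y k)%O%:R))%R))%N.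
Proof.
move=> c0 /fsubsetP AT /fsubsetP BT.
pose U (D : {fset P}) : 'M[F]_(#|` D|, r) :=
  \matrix_(p, k) (tnth (in_tuple D) p <= y k)%O%:R.
have Ufree (D : {fset P}) : {subset D <= T} -> row_free (U D).
  move=> DT; apply: row_free_zeta => [|p]; last exact/DT/mem_tnth.
  by apply/tuple_uniqP; exact: fset_uniq.
pose W := diag_mx (\row_k c k) : 'M[F]_r.
have Wfree : row_free W.
  rewrite row_free_unit unitmxE det_diag unitfE.
  by apply/prodf_neq0 => k _; rewrite mxE.
have rA := eqP (Ufree _ AT); have rB := eqP (Ufree _ BT).
(* Sylvester's inequality with inner dimension [r]; the invertible factor [W] preserves the rank of
   [U B]. *)
have := mxrank_mul_min (U A) (U B *m W)^T.
rewrite mxrank_tr mxrankMfree // rA rB => /leq_trans; apply.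
rewrite leq_eqVlt; apply/orP; left; apply/eqP; congr (\rank _).
apply/matrixP => p q; rewrite !mxE; apply: eq_bigr => k _.
by rewrite mul_mx_diag !mxE mulrA mulrC.
Qed.

End Enumeration.

(** * Existence of ranks, and flattenings of tensors *)

Section Ranks.
Variables (F : fieldType) (n : nat).

Lemma has_sym_polyadicW d (A : tensor F n d) q :
  has_sym_polyadic A q -> has_polyadic A q.
Proof. by case=> q0 [c [B AB]]; split=> //; exists c, (fun=> B). Qed.

Lemma is_smallest_exists (Q : nat -> Prop) q :
  Q q -> exists m, is_smallest Q m.
Proof.
move=> Qq; have exQ : exists m, `[< Q m >] by exists q; exact/asboolP.
case: (ex_minnP exQ) => m /asboolP Qm le_m.
by exists m; split=> // l Ql; apply/le_m/asboolP.
Qed.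

(** Each term of a decomposition splits into a factor in the first [m] indices, which absorbs [c k],
    and one in the last [e], so the matrix factors through dimension [q]. *)
Lemma mxrank_flattening m e (A : tensor F n (m + e)) q a b
    (i : 'I_a -> m.-tuple 'I_n) (j : 'I_b -> e.-tuple 'I_n) :
    has_polyadic A q ->
  (\rank (\matrix_(u < a, v < b) A [tuple of i u ++ j v]) <= q)%N.
Proof.
case=> _ [c [B AB]].
pose L : 'M[F]_(a, q) :=
  \matrix_(u, k) (c k * \prod_(l < m) B (lshift e l) (tnth (i u) l) k).
pose M : 'M[F]_(q, b) :=
  \matrix_(k, v) \prod_(l < e) B (rshift m l) (tnth (j v) l) k.
have -> : \matrix_(u < a, v < b) A [tuple of i u ++ j v] = L *m M.
  apply/matrixP => u v; rewrite !mxE AB; apply: eq_bigr => k _; rewrite !mxE.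
  rewrite big_split_ord /= mulrA; congr (_ * _ * _); apply: eq_bigr => l _.
    by rewrite tnth_lshift.
  by rewrite tnth_rshift.
exact: leq_trans (mxrankM_maxl _ _) (rank_leq_col _).
Qed.

End Ranks.

(** * The symmetric decomposition of the join tensor *)

Section JoinTensor.
Variables (F : fieldType) (disp : Order.disp_t) (P : joinSemilatticeType disp).
Variables (n : nat) (x : 'I_n -> P) (f : P -> F) (d r : nat) (y : 'I_r -> P).
Hypothesis d_gt0 : (0 < d)%N.
Hypothesis card_T : r = #|` join_power x d|.
Hypothesis T_enum : join_power x d = [fset y k | k in 'I_r].

Let c k : F := \sum_(s < r | (y k <= y s)%O)
        f (y s) * (mobius (join_power x d) (y k) (y s))%:~R.

Lemma join_tensorE (i : d.-tuple 'I_n) (p : P) :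
    joins [seq x j | j <- i] = Some p ->
  join_tensor f d x i = \sum_(k < r) c k * (p <= y k)%O%:R.
Proof.
move=> ip; have := mem_join_power ip; rewrite /join_tensor ip /= T_enum.
case/imfsetP => k _ ->; rewrite (mobius_inversion card_T T_enum f k) big_mkcond.
by apply: eq_bigr => t _; case: ifP; rewrite (mulr1, mulr0).
Qed.

Lemma join_tensor_sym_polyadic : is_polyadic (join_tensor f d x) c
  (fun=> \matrix_(i, k) (x i <= y k)%O%:R).
Proof.
move=> i; have [|p ip] := @joins_some _ _ [seq x j | j <- i].
  by rewrite size_map size_tuple.
rewrite (join_tensorE ip); apply: eq_bigr => k _; congr (_ * _).
(* A join lies below [y k] iff all its arguments do, so its indicator is the product of theirs. *)
rewrite (joins_le _ ip) all_map -forallb_tnth.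
case: forallP => [ik|/forallP/forallPn[l /negPf lk]].
  by rewrite big1 // => l _; rewrite mxE; have /= -> := ik l.
by rewrite (bigD1 l) //= mxE; rewrite /= in lk; rewrite lk mul0r.
Qed.

End JoinTensor.

(** * Lower bound by flattening, and the combined rank estimates *)

Lemma join_tensor_rank_lower (F : fieldType) (disp : Order.disp_t)
    (P : joinSemilatticeType disp) (n : nat) (x : 'I_n -> P) (f : P -> F)
    (m e r : nat) (y : 'I_r -> P) (q : nat) :
    (0 < m)%N -> (m <= e)%N ->
    r = #|` join_power x (m + e)| ->
    join_power x (m + e) = [fset y k | k in 'I_r] ->
    (forall i j : 'I_r, (y i <= y j)%O -> (i <= j)%N) ->
    (forall k : 'I_r, \sum_(s < r | (y k <= y s)%O)
       f (y s) * (mobius (join_power x (m + e)) (y k) (y s))%:~R != 0) ->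
    has_polyadic (join_tensor f (m + e) x) q ->
  (#|` join_power x m| + #|` join_power x e| - r <= q)%N.
Proof.
move=> m_gt0 me card_T T_enum y_ord c_neq0 Aq.
set A := join_power x m; set B := join_power x e.
have tup k (D := join_power x k) (u : 'I_#|` D|) :
    exists i : k.-tuple 'I_n, joins [seq x j | j <- i] = Some (tnth (in_tuple D) u).
  by have /join_powerP[i _ ip] := mem_tnth u (in_tuple D); exists i.
(* One index tuple is chosen per join; these select the rows and columns kept from the
   flattening. *)
have [i ip] := choice (tup m); have [j jq] := choice (tup e).
have AT : A `<=` join_power x (m + e).
  by apply/fsubsetP/join_power_sub; rewrite geq_min leq_addr orbT.
have BT : B `<=` join_power x (m + e).
  by apply/fsubsetP/join_power_sub; rewrite geq_min leq_addl orbT.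
have := mxrank_zeta_product T_enum y_ord c_neq0 AT BT.
move/leq_trans; apply; apply: leq_trans (mxrank_flattening i j Aq).
rewrite leq_eqVlt; apply/orP; left; apply/eqP; congr (\rank _).
apply/matrixP => u v; rewrite !mxE.
have [|w ijw] := @joins_some _ _ [seq x l | l <- [tuple of i u ++ j v]].
  by rewrite size_map size_tuple addn_gt0 m_gt0.
rewrite (join_tensorE f card_T T_enum ijw); apply: eq_bigr => k _; congr (_ * _).
rewrite map_cat in ijw; rewrite (joins_cat (ip u) (jq v) ijw) leUx.
by rewrite -natrM mulnb.
Qed.

Theorem corollary4p3 (R : realType)
  (disp : Order.disp_t) (P : joinSemilatticeType disp)
  (P_locfin : locally_finite P)
  (n : nat) (n_gt0 : (0 < n)%N)
  (x : 'I_n -> P) (x_ord : forall i j : 'I_n, (x i <= x j)%O -> (i <= j)%N)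
  (f : P -> R[i]) (d : nat) (d_ge2 : (2 <= d)%N)
  (r : nat) (r_card : r = #|` join_power x d|)
  (y : 'I_r -> P) (y_enum : join_power x d = [fset y k | k in 'I_r])
  (y_ord : forall i j : 'I_r, (y i <= y j)%O -> (i <= j)%N)
  (c_neq0 : forall k : 'I_r,
     \sum_(s < r | (y k <= y s)%O)
        f (y s) * (mobius (join_power x d) (y k) (y s))%:~R != 0) :
  exists rCP rSym : nat,
    [/\ is_rank_CP (join_tensor f d x) rCP,
        is_rank_Sym (join_tensor f d x) rSym,
        [/\ 2 * #|` join_power x d./2|%:Z - #|` join_power x d|%:Z <= rCP%:Z,
            (rCP <= rSym)%N
          & (rSym <= #|` join_power x d|)%N]
      & (n <= d./2)%N ->
          rCP = rSym /\ rSym = #|` join_power x d./2|].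
Proof.
have d_gt0 : (0 < d)%N by exact: ltnW.
have m_gt0 : (0 < d./2)%N by lia.
have dE : d = (d./2 + uphalf d)%N by lia.
have me : (d./2 <= uphalf d)%N by rewrite uphalf_half leq_addl.
have sym : has_sym_polyadic (join_tensor f d x) r.
  split; first by rewrite r_card card_join_power_gt0.
  by do 2!eexists; exact: (join_tensor_sym_polyadic f d_gt0 r_card y_enum).
have [rSym [symS minS]] := is_smallest_exists sym.
have [rCP [polC minC]] := is_smallest_exists (has_sym_polyadicW sym).
have le_CS : (rCP <= rSym)%N by exact/minC/has_sym_polyadicW.
have le_S : (rSym <= r)%N by exact: minS.
have lower : (#|` join_power x d./2| + #|` join_power x (uphalf d)| - r <= rCP)%N.
  (* The halves become variables so that [d] can be replaced by [m + e] inside the tuple types. *)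
  move: (d./2) (uphalf d) m_gt0 me dE => m e m_gt0 me dE.
  move: r_card y_enum c_neq0 polC; rewrite {}dE => r_card' y_enum' c_neq0'.
  exact: (join_tensor_rank_lower m_gt0 me r_card' y_enum' y_ord c_neq0').
(* This turns the sum of the two cardinalities in [lower] into twice the smaller one. *)
have le_me : (#|` join_power x d./2| <= #|` join_power x (uphalf d)|)%N.
  by apply: card_join_power_le; rewrite geq_min me orbT.
exists rCP, rSym; split => //; first split => //; rewrite -?r_card //; first lia.
move=> nm.
(* Together with [mr] this makes the half-degree cardinality equal to [r], so the lower bound
   becomes [2r - r] and meets the upper bound. *)
have rm : (r <= #|` join_power x d./2|)%N.
  by rewrite r_card; apply: card_join_power_le; rewrite geq_min nm.
have mr : (#|` join_power x d./2| <= r)%N.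
  by rewrite r_card; apply: card_join_power_le; rewrite geq_min; apply/orP; right; lia.
by split; lia.
Qed.
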